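(* A right-angled Artin group whose defining graph has a closed path of odd length cannot be (isomorphic to) a subgroup of a right-angled Artin group whose defining graph has no closed path of odd length.
   Context: The right-angled Artin group (RAAG) defined by a finite simplicial graph has one generator for each vertex, with defining relations that two generators commute whenever the corresponding vertices are joined by an edge. All defining graphs are finite. *)

(* Defs.v *)
From HB Require Import structures.
From mathcomp Require Import all_boot.
From mathcomp Require Import boolp.

Set Implicit Arguments.
Unset Strict Implicit.
Unset Printing Implicit Defensive.

Local Open Scope quotient_scope.
Local Open Scope group_scope.

(* A finite simplicial graph is a finite type of vertices together with a
   symmetric irreflexive adjacency relation. *)
Definition simplicial (V : finType) (e : rel V) : Prop :=
  symmetric e /\ irreflexive e.

(* [cycle e [:: v1; ...; vn]] says that v1 - v2 - ... - vn - v1 is a closed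
   path; it traverses n edges.  Repeated vertices are allowed. *)
Definition has_odd_closed_path (V : finType) (e : rel V) : Prop :=
  exists2 c : seq V, cycle e c & odd (size c).

Section RightAngledArtinGroup.
Variables (V : finType) (e : rel V).

(* The letter (v, true) is the generator v, and (v, false) its inverse. *)
Definition letter : Type := (V * bool)%type.
Definition word : Type := seq letter.

(* The least congruence on the free monoid of words that contains free
   cancellation and the commutation of adjacent vertices. *)
Inductive raag_eq : word -> word -> Prop :=
| raag_refl w : raag_eq w w
| raag_sym w1 w2 : raag_eq w1 w2 -> raag_eq w2 w1
| raag_trans w1 w2 w3 : raag_eq w1 w2 -> raag_eq w2 w3 -> raag_eq w1 w3
| raag_cat w1 w1' w2 w2' :
    raag_eq w1 w1' -> raag_eq w2 w2' -> raag_eq (w1 ++ w2) (w1' ++ w2')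
| raag_cancel v b : raag_eq [:: (v, b); (v, ~~ b)] [::]
| raag_comm v1 v2 : e v1 v2 ->
    raag_eq [:: (v1, true); (v2, true)] [:: (v2, true); (v1, true)].

Definition raag_eqb : rel word := fun w1 w2 => `[< raag_eq w1 w2 >].

Lemma raag_eqb_refl : reflexive raag_eqb.
Proof. by move=> w; apply/asboolP; apply: raag_refl. Qed.

Lemma raag_eqb_sym : symmetric raag_eqb.
Proof. by move=> w1 w2; apply/asboolP/asboolP; apply: raag_sym. Qed.

Lemma raag_eqb_trans : transitive raag_eqb.
Proof.
move=> w2 w1 w3 /asboolP w12 /asboolP w23.
by apply/asboolP; apply: raag_trans w12 w23.
Qed.

Canonical raag_equiv : equiv_rel word :=
  EquivRel raag_eqb raag_eqb_refl raag_eqb_sym raag_eqb_trans.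

Definition raag : Type := {eq_quot raag_equiv}.
HB.instance Definition _ := Choice.on raag.
HB.instance Definition _ := Quotient.on raag.

Definition raag_of (w : word) : raag := \pi_raag w.

Lemma raag_ofP w1 w2 : raag_of w1 = raag_of w2 <-> raag_eq w1 w2.
Proof.
split; first by move/eqmodP/asboolP.
by move=> w12; apply/eqmodP/asboolP.
Qed.

Lemma raag_of_repr (x : raag) : raag_of (repr x) = x.
Proof. exact: reprK. Qed.

Definition inv_word (w : word) : word := rev [seq (l.1, ~~ l.2) | l <- w].

Lemma inv_word_cat w1 w2 : inv_word (w1 ++ w2) = inv_word w2 ++ inv_word w1.
Proof. by rewrite /inv_word map_cat rev_cat. Qed.

Lemma inv_word_mulVw w : raag_eq (inv_word w ++ w) [::].
Proof.
elim: w => [|[v b] w IHw]; first exact: raag_refl.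
rewrite -cat1s inv_word_cat -catA (catA (inv_word [:: (v, b)])).
apply: raag_trans IHw; apply: raag_cat; first exact: raag_refl.
rewrite -{2}[w]cat0s; apply: raag_cat; last exact: raag_refl.
by have := raag_cancel v (~~ b); rewrite negbK.
Qed.

Lemma inv_wordK : involutive inv_word.
Proof.
move=> w; rewrite /inv_word map_rev revK -map_comp -[RHS]map_id.
by apply: eq_map => -[v b] /=; rewrite negbK.
Qed.

Lemma inv_word_mulwV w : raag_eq (w ++ inv_word w) [::].
Proof. by rewrite -{1}[w]inv_wordK; apply: inv_word_mulVw. Qed.

Definition raag_one : raag := raag_of [::].
Definition raag_mul (x y : raag) : raag := raag_of (repr x ++ repr y).
Definition raag_inv (x : raag) : raag := raag_of (inv_word (repr x)).

Lemma raag_repr_of w : raag_eq (repr (raag_of w)) w.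
Proof. by apply/raag_ofP; rewrite raag_of_repr. Qed.

Lemma raag_mulE w1 w2 : raag_mul (raag_of w1) (raag_of w2) = raag_of (w1 ++ w2).
Proof. by apply/raag_ofP; apply: raag_cat; apply: raag_repr_of. Qed.

Lemma raag_mulA : associative raag_mul.
Proof.
move=> x y z; rewrite -(raag_of_repr x) -(raag_of_repr y) -(raag_of_repr z).
by rewrite !raag_mulE catA.
Qed.

Lemma raag_mul1 : left_id raag_one raag_mul.
Proof. by move=> x; rewrite -(raag_of_repr x) raag_mulE. Qed.

Lemma raag_mulr1 : right_id raag_one raag_mul.
Proof. by move=> x; rewrite -(raag_of_repr x) raag_mulE cats0. Qed.

Lemma raag_mulV : left_inverse raag_one raag_inv raag_mul.
Proof.
move=> x; rewrite -{2}(raag_of_repr x) raag_mulE.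
by apply/raag_ofP; apply: inv_word_mulVw.
Qed.

Lemma raag_mulrV : right_inverse raag_one raag_inv raag_mul.
Proof.
move=> x; rewrite -{1}(raag_of_repr x) raag_mulE.
by apply/raag_ofP; apply: inv_word_mulwV.
Qed.

HB.instance Definition _ := isGroup.Build raag
  raag_mulA raag_mul1 raag_mulr1 raag_mulV raag_mulrV.

Definition raag_gen (v : V) : raag := raag_of [:: (v, true)].

Lemma raag_ofM w1 w2 : raag_of (w1 ++ w2) = raag_of w1 * raag_of w2.
Proof. by rewrite -raag_mulE. Qed.

Lemma raag_ofV w : raag_of (inv_word w) = (raag_of w)^-1.
Proof.
apply: (mulIg (raag_of w)); rewrite mulVg -raag_ofM.
by apply/raag_ofP; apply: inv_word_mulVw.
Qed.

Lemma raag_gen_commute v1 v2 : e v1 v2 -> commute (raag_gen v1) (raag_gen v2).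
Proof.
by move=> e12; rewrite /commute -!raag_ofM; apply/raag_ofP/raag_comm.
Qed.

(* Together with [raag_gen_commute], existence in the universal property of
   the presentation. *)
Lemma raag_lift (G : groupType) (g : V -> G) :
  (forall v1 v2, e v1 v2 -> commute (g v1) (g v2)) ->
  exists phi : {multiplicative raag -> G}, forall v, phi (raag_gen v) = g v.
Proof.
move=> gC; pose gl (l : letter) := if l.2 then g l.1 else (g l.1)^-1.
pose gw (w : word) := foldr (fun l x => gl l * x) 1 w.
have gw_cat w1 w2 : gw (w1 ++ w2) = gw w1 * gw w2.
  by elim: w1 => [|l w1 IH] /=; rewrite ?mul1g // IH mulgA.
have gw_eq w1 w2 : raag_eq w1 w2 -> gw w1 = gw w2.
  elim=> {w1 w2} //= [w1 w2 w3 _ -> _ -> //|w1 w1' w2 w2' _ E1 _ E2||].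
  - by rewrite !gw_cat E1 E2.
  - by move=> v [] /=; rewrite /gl /= mulg1 ?mulgV ?mulVg.
  - by move=> v1 v2 /gC g12; rewrite /gl /= !mulg1.
pose phi (x : raag) := gw (repr x).
have phi_of w : phi (raag_of w) = gw w by apply/gw_eq/raag_repr_of.
have phiM : {morph phi : x y / x * y}.
  move=> x y; rewrite -(raag_of_repr x) -(raag_of_repr y) -raag_ofM.
  by rewrite !phi_of gw_cat.
pose phiH := isMultiplicative.Build raag G phi phiM.
exists (HB.pack_for {multiplicative raag -> G} phi phiH) => v /=.
by rewrite phi_of /= mulg1.
Qed.

End RightAngledArtinGroup.

Definition isomorphic_to_subgroup (G K : groupType) : Prop :=
  exists2 S : {pred K}, group_closed S &
  exists2 phi : {multiplicative G -> K},
    injective phi & forall y : K, y \in S <-> exists x : G, phi x = y.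

(* Main.v *)
(* Let the bipartite graph have parts A and B, and let pA, pB be the maps of
   its group G to free groups that kill the generators in B, resp. in A.  Then
   G = ker pB x| F(B), where ker pB is free on the conjugates of A by F(B); the
   generators conjugate to a given a in A are the cosets of F(lk a) in F(B),
   permuted by F(B).

   Given an embedding of the other group, let x_v be the image of its generator v.
   - ker pB is free, so adjacent v, w do not both satisfy pB x_v = pB x_w = 1,
     and likewise for pA.
   - If t <> 1 lies in ker pA and ker pB, then every element commuting with t
     lies in ker pB: a nontrivial h in F(B) fixes at most one coset of F(lk a)
     for each a, and has infinite orbits on the others, which forces t to be
     conjugate to a word in the fixed letters; pA is injective on those words.
   - If v has distinct nonadjacent neighbours u, w and both pA x_v, pB x_v are
     nontrivial, then t = [x_u, x_w] contradicts the previous point, since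
     commutation is transitive on nontrivial elements of a free group.
   So along an odd closed path without backtracking in a triangle-free graph
   exactly one of pA x_v, pB x_v is trivial and the two cases alternate, which
   is absurd.  A triangle would give Z^3 inside a free-by-free group. *)

Require Import Defs.
From mathcomp Require Import all_boot.
From HB Require Import structures.
From mathcomp Require Import boolp.

Set Implicit Arguments.
Unset Strict Implicit.
Unset Printing Implicit Defensive.

Local Open Scope group_scope.

(** * Free groups *)

(* The library states these facts for [UMagmaMorphism] only. *)
Section GroupHom.
Variables (G H : groupType) (f : {multiplicative G -> H}).

Lemma hom1g : f 1 = 1.
Proof. by apply: (mulgI (f 1)); rewrite -gmulfM !mulg1. Qed.

Lemma homVg : {morph f : x / x^-1}.
Proof. by move=> x; apply: (mulgI (f x)); rewrite -gmulfM !mulgV hom1g. Qed.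

Lemma homXg n : {morph f : x / x ^+ n}.
Proof.
by move=> x; elim: n => [|n IH]; rewrite ?hom1g // !expgS gmulfM IH.
Qed.

Lemma homJg : {morph f : x y / x ^ y}.
Proof. by move=> x y; rewrite !gmulfM homVg. Qed.

Lemma homRg : {morph f : x y / [~ x, y]}.
Proof. by move=> x y; rewrite !gmulfM !homVg. Qed.

End GroupHom.

Section FreeGroupWords.
Variable T : choiceType.
Implicit Types (l m : T * bool) (u v w : seq (T * bool)).

Definition linv l : T * bool := (l.1, ~~ l.2).

Lemma linvK : involutive linv.
Proof. by case=> x b; rewrite /linv /= negbK. Qed.

Lemma linv_neq l : linv l != l.
Proof. by case: l => x b; rewrite /linv xpair_eqE eqxx; case: b. Qed.

Definition ncancel : rel (T * bool) := fun l m => m != linv l.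

Lemma ncancelC l m : ncancel l m = ncancel m l.
Proof. by rewrite /ncancel eq_sym (inv_eq linvK). Qed.

Lemma ncancelV l m : ncancel (linv l) (linv m) = ncancel l m.
Proof. by rewrite /ncancel (inj_eq (inv_inj linvK)). Qed.

Definition reduced w := sorted ncancel w.

Definition winv w := rev (map linv w).

Lemma winvK : involutive winv.
Proof.
by move=> w; rewrite /winv map_rev revK -map_comp map_id_in // => l _ /=; rewrite linvK.
Qed.

Lemma size_winv w : size (winv w) = size w.
Proof. by rewrite /winv size_rev size_map. Qed.

Lemma reduced_winv w : reduced (winv w) = reduced w.
Proof.
rewrite /reduced /winv rev_sorted sorted_map; apply: eq_sorted => l m /=.
by rewrite ncancelV ncancelC.
Qed.

Definition push l w :=
  if w is m :: w' then if m == linv l then w' else l :: w else [:: l].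

Definition red w := foldr push [::] w.

Lemma push_reduced l w : reduced w -> reduced (push l w).
Proof.
case: w => [|m w] //= mw; case: eqP => [_|/eqP lm]; first exact: path_sorted mw.
by rewrite /= /ncancel lm.
Qed.

Lemma pushK l w : reduced w -> push (linv l) (push l w) = w.
Proof.
case: w => [|m w] /=; first by rewrite linvK eqxx.
case: eqP => [->|_ _] /=; last by rewrite linvK eqxx.
by case: w => //= m' w /andP[]; rewrite /ncancel => /negbTE ->.
Qed.

Lemma foldr_push_reduced u v : reduced v -> reduced (foldr push v u).
Proof. by elim: u => //= l u IH /IH/push_reduced. Qed.

Lemma red_reduced w : reduced (red w).
Proof. exact: foldr_push_reduced. Qed.

Lemma red_id w : reduced w -> red w = w.
Proof.
elim: w => //= l w IH lw; have rw : reduced w := path_sorted lw.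
rewrite /red /= -/(red w) IH //.
by case: w lw {IH rw} => //= m w /andP[]; rewrite /ncancel => /negbTE ->.
Qed.

(** Van der Waerden's argument: by [pushK] a letter and its inverse act on reduced words as inverse
    maps, so the action of [u] depends only on [red u]. *)
Lemma foldr_push_red u v : reduced v -> foldr push v u = foldr push v (red u).
Proof.
move=> rv; elim: u => //= l u ->.
case: (red u) => //= m w; case: eqP => //= ->.
by rewrite -{1}[l]linvK pushK // foldr_push_reduced.
Qed.

Lemma red_catl u v : red (red u ++ v) = red (u ++ v).
Proof. by rewrite /red !foldr_cat -foldr_push_red ?red_reduced. Qed.

Lemma red_catr u v : red (u ++ red v) = red (u ++ v).
Proof. by rewrite {1 3}/red !foldr_cat -/(red _) red_id ?red_reduced. Qed.

Lemma red_winv_cat w : red (winv w ++ w) = [::].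
Proof.
elim: w => // l w IH; rewrite /winv map_cons rev_cons cat_rcons.
rewrite -/(winv w) -IH -[RHS]red_catr -red_catr; congr (red (_ ++ _)).
by rewrite -[RHS](pushK l) ?red_reduced.
Qed.

Lemma size_push l w : size (push l w) <= (size w).+1.
Proof. by case: w => //= m w; case: eqP => //= _; rewrite ltnW ?ltnS. Qed.

Lemma push_size_cons l w : size (push l w) = (size w).+1 -> push l w = l :: w.
Proof.
case: w => //= m w; case: eqP => //= _ sz.
by have := leqnSn (size w).+1; rewrite -{1}sz ltnn.
Qed.

Lemma size_foldr_push u v : size (foldr push v u) <= size u + size v.
Proof. by elim: u => //= l u IH; apply: leq_trans (size_push _ _) _. Qed.

(** Each [push] adds at most one letter, so full length means that nothing has cancelled. *)
Lemma red_cat_size u v : reduced v ->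
  size (red (u ++ v)) = (size u + size v)%N -> red (u ++ v) = u ++ v.
Proof.
move=> rv; rewrite /red foldr_cat -/(red v) red_id //.
elim: u => //= l u IH sz.
have F : size (foldr push v u) = (size u + size v)%N.
  by apply/eqP; rewrite eqn_leq size_foldr_push -ltnS -addSn -sz size_push.
have E : push l (foldr push v u) = l :: foldr push v u.
  by apply: push_size_cons; rewrite F.
by rewrite E IH.
Qed.

Lemma size_flatten_nseq n w : size (flatten (nseq n w)) = (n * size w)%N.
Proof. by elim: n => //= n IH; rewrite size_cat IH mulSn. Qed.

Lemma cycle_reduced w : cycle ncancel w -> reduced w.
Proof. by case: w => //= l w; rewrite rcons_path => /andP[]. Qed.

Lemma path_nseq n l w (y := l :: w) : cycle ncancel y ->
  path ncancel l (w ++ flatten (nseq n y)) /\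
  last l (w ++ flatten (nseq n y)) = last l w.
Proof.
rewrite /y /= rcons_path => /andP[pw lw].
elim: n => [|n [IH1 IH2]] /=; first by rewrite cats0.
by rewrite cat_path pw /= lw last_cat /=.
Qed.

Lemma cycle_nseq n w : cycle ncancel w -> cycle ncancel (flatten (nseq n w)).
Proof.
case: w => [|l w]; first by elim: n.
case: n => // n cw; have [pn ln] := path_nseq n cw.
by move: cw; rewrite /= !rcons_path pn ln => /andP[].
Qed.

(** Peel off the first and last letters while they cancel. The core [y] is cyclically reduced, so
    its powers are plain concatenations. *)
Lemma cyclic_decomp w : reduced w ->
  exists p y, w = p ++ y ++ winv p /\ cycle ncancel y.
Proof.
have [n] := ubnP (size w); elim: n w => // n IH [|l w] /= le rw.
  by exists [::], [::].
have [c|] := boolP (cycle ncancel (l :: w)); first by exists [::], (l :: w); rewrite /= cats0.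
case/lastP: w le rw => [|w m] /=; first by rewrite /ncancel eq_sym linv_neq.
rewrite size_rcons ltnS !rcons_path last_rcons => le /andP[rw mw].
rewrite rw mw /= negbK => /eqP lm.
have [||p [y [-> cy]]] := IH w; [exact: ltnW|exact: path_sorted rw|].
exists (l :: p), y; split=> //; rewrite /winv map_cons rev_cons lm linvK.
by rewrite -!cats1 !catA.
Qed.

Lemma reduced_cat_cons p l w :
  reduced (p ++ l :: w) = reduced (rcons p l) && path ncancel l w.
Proof. by case: p => //= m p; rewrite rcons_path cat_path /= andbA. Qed.

Lemma reduced_conj_nseq n p y : reduced (p ++ y ++ winv p) -> cycle ncancel y ->
  reduced (p ++ flatten (nseq n.+1 y) ++ winv p).
Proof.
case: y => [|l w]; first by elim: n.
rewrite reduced_cat_cons cat_path => /and3P[pl _ wp] /(path_nseq n)[pn ln].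
by rewrite /= reduced_cat_cons pl cat_path pn ln.
Qed.

(* Equal lengths turn commutation of words into equality. *)
Lemma commuting_words u v : u ++ v = v ++ u ->
  flatten (nseq (size v) u) = flatten (nseq (size u) v).
Proof.
move=> uv.
have uvn n : flatten (nseq n u) ++ v = v ++ flatten (nseq n u).
  by elim: n => [|n IH] /=; rewrite ?cats0 // -catA IH catA uv -catA.
have unvm n k :
    flatten (nseq n u) ++ flatten (nseq k v) = flatten (nseq k v) ++ flatten (nseq n u).
  by elim: k => [|k IH] /=; rewrite ?cats0 // -catA -IH catA uvn -catA.
have /(congr1 (take (size v * size u))) := unvm (size v) (size u).
by rewrite {1}mulnC !takel_cat ?take_oversize ?size_flatten_nseq // mulnC.
Qed.

Lemma flatten_nseq_inj n u v : flatten (nseq n.+1 u) = flatten (nseq n.+1 v) -> u = v.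
Proof.
move=> uv; have /eqP := congr1 size uv.
rewrite !size_flatten_nseq eqn_pmul2l // => /eqP suv.
by move/(congr1 (take (size u))): uv => /=; rewrite {2}suv !take_size_cat.
Qed.

End FreeGroupWords.

(** Reduced words are normal forms, so equality of elements is equality of words. The alphabet may
    be infinite, as the set of cosets used below can be. *)
Record free_group (T : choiceType) :=
  FreeGroup { fword : seq (T * bool); fword_reduced : reduced fword }.

HB.instance Definition _ T := [isSub for @fword T].
HB.instance Definition _ T := [Choice of free_group T by <:].

(** * The group of reduced words: roots, commutation, universal property *)

Section FreeGroup.
Variable T : choiceType.
Implicit Types (x y z : free_group T) (u v w : seq (T * bool)).

Definition fg w : free_group T := FreeGroup (red_reduced w).

Lemma fg_fword x : fg (fword x) = x.
Proof. by apply: val_inj; rewrite /= red_id ?fword_reduced. Qed.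

Definition fg_mul x y := fg (fword x ++ fword y).
Definition fg_inv x := fg (winv (fword x)).

Lemma fg_mulE u v : fg_mul (fg u) (fg v) = fg (u ++ v).
Proof. by apply: val_inj; rewrite /= red_catl red_catr. Qed.

Fact fg_mulA : associative fg_mul.
Proof.
by move=> x y z; rewrite -(fg_fword x) -(fg_fword y) -(fg_fword z) !fg_mulE catA.
Qed.

Fact fg_mul1 : left_id (fg [::]) fg_mul.
Proof. by move=> x; rewrite -(fg_fword x) fg_mulE. Qed.

Fact fg_mulr1 : right_id (fg [::]) fg_mul.
Proof. by move=> x; rewrite -(fg_fword x) fg_mulE cats0. Qed.

Fact fg_mulV : left_inverse (fg [::]) fg_inv fg_mul.
Proof.
move=> x; rewrite -{2}(fg_fword x) fg_mulE.
by apply: val_inj; rewrite /= red_winv_cat.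
Qed.

Fact fg_mulrV : right_inverse (fg [::]) fg_inv fg_mul.
Proof.
move=> x; rewrite -{1}(fg_fword x) fg_mulE.
by apply: val_inj; rewrite /= -{1}(winvK (fword x)) red_winv_cat.
Qed.

HB.instance Definition _ := isGroup.Build (free_group T)
  fg_mulA fg_mul1 fg_mulr1 fg_mulV fg_mulrV.

Definition fgen (t : T) : free_group T := fg [:: (t, true)].

Lemma fg1 : fg [::] = 1. Proof. by []. Qed.

Lemma fgM u v : fg (u ++ v) = fg u * fg v.
Proof. by rewrite -fg_mulE. Qed.

Lemma fgV w : fg (winv w) = (fg w)^-1.
Proof.
apply: (mulIg (fg w)); rewrite mulVg -fgM.
by apply: val_inj; rewrite /= red_winv_cat.
Qed.

Lemma fgX n w : fg (flatten (nseq n w)) = fg w ^+ n.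
Proof. by elim: n => //= n IH; rewrite fgM IH expgS. Qed.

Lemma fword_fg w : reduced w -> fword (fg w) = w.
Proof. exact: red_id. Qed.

Lemma fword_eq1 x : (size (fword x) == 0) = (x == 1).
Proof.
apply/idP/eqP => [/nilP x1|-> //].
by rewrite -(fg_fword x) x1.
Qed.

Lemma fg_cyclic_conj x : exists z y, cycle (@ncancel T) (fword y) /\ x = y ^ z.
Proof.
have [p [y [xE cy]]] := cyclic_decomp (fword_reduced x).
exists (fg (winv p)), (fg y); rewrite fword_fg ?cycle_reduced //; split=> //.
by rewrite -[LHS]fg_fword xE !fgM conjgE !fgV invgK.
Qed.

(** Conjugate until [x] is cyclically reduced and write [y] as a conjugate of a cyclically reduced
    word. Both powers are then free of cancellation and can be compared as words. *)
Lemma fg_root_uniq n x y : x ^+ n.+1 = y ^+ n.+1 -> x = y.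
Proof.
have [z [x' [cx ->]]] := fg_cyclic_conj x.
rewrite -[y](conjgKV z); move: (y ^ z^-1) => {}y.
rewrite -!conjXg => /conjg_inj xy; congr (_ ^ z).
have [p [w [yE cw]]] := cyclic_decomp (fword_reduced y).
have rp : reduced (p ++ w ++ winv p) by rewrite -yE fword_reduced.
have yX : y ^+ n.+1 = fg (p ++ flatten (nseq n.+1 w) ++ winv p).
  have -> : y = (fg w) ^ (fg (winv p)).
    by rewrite -[LHS]fg_fword yE !fgM conjgE !fgV invgK.
  by rewrite -conjXg conjgE -fgX !fgM !fgV invgK.
move: xy => /(congr1 (@fword T)); rewrite yX fword_fg ?reduced_conj_nseq //.
rewrite -{1}(fg_fword x') -fgX fword_fg; last first.
  exact/cycle_reduced/cycle_nseq.
case: p yE {rp yX} => [|l p] yE xy.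
  apply: val_inj; rewrite /= yE /= cats0; apply: (@flatten_nseq_inj _ n).
  by rewrite xy /= cats0.
(* A nonempty [p] would make the first and last letters of the power of [y] cancel, but the power of
   [x'] is cyclically reduced. *)
have := cycle_nseq n.+1 cx; rewrite xy /winv map_cons rev_cons -!rcons_cat /=.
by rewrite rcons_path last_rcons /ncancel linvK eqxx andbF.
Qed.

Lemma fg_torsion_free n x : x ^+ n.+1 = 1 -> x = 1.
Proof. by move=> xn; apply: (@fg_root_uniq n); rewrite expg1n. Qed.

Lemma fword_inv x : fword x^-1 = winv (fword x).
Proof. by rewrite -{1}(fg_fword x) -fgV fword_fg ?reduced_winv ?fword_reduced. Qed.

(** Since [x y] is reduced, [y x] has full length too and does not cancel either, so the words
    commute in the free monoid and [commuting_words] applies. *)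
Lemma fg_commute_cat x y : commute x y -> reduced (fword x ++ fword y) ->
  x ^+ size (fword y) = y ^+ size (fword x).
Proof.
move=> xy rxy; rewrite -[in LHS](fg_fword x) -[in RHS](fg_fword y) -!fgX.
congr fg; apply: commuting_words.
have yxE : red (fword y ++ fword x) = fword x ++ fword y.
  by rewrite -(red_id rxy); apply/esym/(congr1 (@fword T) xy).
by rewrite -yxE red_cat_size ?fword_reduced // yxE size_cat addnC.
Qed.

Lemma fword_neq1 x : x != 1 -> exists n, size (fword x) = n.+1.
Proof. by rewrite -fword_eq1; case: size => // n; exists n. Qed.

(* A cyclically reduced [x] cannot cancel against [y] at both ends, so [x]
   commutes with [y] or [y^-1] already in the free monoid. *)
Lemma fg_commute_cyclic x y : cycle (@ncancel T) (fword x) -> x != 1 -> y != 1 ->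
  commute x y ->
  exists i j, x ^+ i.+1 = y ^+ j.+1 \/ x ^+ i.+1 = y^-1 ^+ j.+1.
Proof.
move=> cx x1 y1 xy.
have [j sx] := fword_neq1 x1; have [i sy] := fword_neq1 y1; exists i, j.
have [ryx|] := boolP (reduced (fword y ++ fword x)).
  by left; rewrite -sx -sy; apply/esym/fg_commute_cat.
move=> ryx; right.
have sVy : size (fword y^-1) = i.+1 by rewrite fword_inv size_winv.
rewrite -sx -sVy; apply: fg_commute_cat; first exact: commuteV.
rewrite fword_inv; case xE: (fword x) cx sx ryx => [|l w] // cx _.
have := fword_reduced y; case/lastP: (fword y) sy => // v m _ ry.
rewrite reduced_cat_cons; move: cx; rewrite /= rcons_path => /andP[lw wl].
have -> : reduced (rcons (rcons v m) l) = ncancel m l.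
  case: v ry => [|m' v] /=; first by rewrite andbT.
  by rewrite /= !rcons_path last_rcons => ->.
rewrite lw andbT negbK => /eqP lm; move: wl; rewrite lm => wl.
have -> : winv (rcons v m) = linv m :: winv v by rewrite /winv map_rcons rev_rcons.
have : reduced (winv (rcons v m)) by rewrite reduced_winv.
rewrite /winv map_rcons rev_rcons /= cat_path /= => ->.
by rewrite -lm lw lm wl.
Qed.

Lemma fg_commute_power x y : x != 1 -> y != 1 -> commute x y ->
  exists i j, x ^+ i.+1 = y ^+ j.+1 \/ x ^+ i.+1 = y^-1 ^+ j.+1.
Proof.
have [z [x' [cx ->]]] := fg_cyclic_conj x.
rewrite -[y](conjgKV z); move: (y ^ z^-1) => {}y; rewrite !conjg_eq1 => x1 y1 xy.
have {}xy : commute x' y.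
  by apply: (@conjg_inj _ z); rewrite !conjMg.
have [i [j ij]] := fg_commute_cyclic cx x1 y1 xy; exists i, j.
by rewrite -!conjVg -!conjXg; case: ij => ->; [left|right].
Qed.

(** A power of [x] is a power of [y] or [y^-1], so [z] commutes with it. Then [x] and [x ^ z] have a
    common power of the same exponent and are equal by uniqueness of roots. *)
Lemma fg_commute_trans x y z : y != 1 -> commute x y -> commute y z -> commute x z.
Proof.
move=> y1 xy yz; have [->|x1] := eqVneq x 1; first exact/commute_sym/commute1.
have [i [j xE]] := fg_commute_power x1 y1 xy.
have zx : commute z (x ^+ i.+1).
  by case: xE => ->; apply: commuteX; [|apply: commuteV]; apply: commute_sym.
apply/commgP/conjg_fixP/(@fg_root_uniq i); rewrite -conjXg.
by apply/conjg_fixP/commgP/commute_sym.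
Qed.

(** Both signs in [fg_commute_power] fit one equation with natural exponents, by taking [j] or [k]
    to be 0. *)
Lemma fg_commute_relation x y : x != 1 -> commute x y ->
  exists i j k, y ^+ i.+1 * x ^+ j = x ^+ k.
Proof.
move=> x1 xy; have [->|y1] := eqVneq y 1; first by exists 0, 0, 0; rewrite expg1n mulg1.
have [j [i [yE|yE]]] := fg_commute_power y1 x1 (commute_sym xy).
  by exists j, 0, i.+1; rewrite yE mulg1.
by exists j, i.+1, 0; rewrite yE expVgn mulVg.
Qed.

Variable G : groupType.

Lemma fg_lift_subproof (g : T -> G) :
  {f : {multiplicative free_group T -> G} |
    forall w, f (fg w) = foldr (fun l a => (if l.2 then g l.1 else (g l.1)^-1) * a) 1 w}.
Proof.
pose gl (l : T * bool) := if l.2 then g l.1 else (g l.1)^-1.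
pose gw w := foldr (fun l a => gl l * a) 1 w.
have glV l : gl (linv l) = (gl l)^-1 by case: l => t [] //=; rewrite /gl /= invgK.
have gw_push l w : gw (push l w) = gl l * gw w.
  by case: w => //= m w; case: eqP => //= ->; rewrite glV mulgA mulgV mul1g.
have gw_cat u v : gw (u ++ v) = gw u * gw v.
  by elim: u => [|l u IH] /=; rewrite ?mul1g // IH mulgA.
have gw_red w : gw (red w) = gw w by elim: w => //= l w IH; rewrite gw_push IH.
pose f x := gw (fword x).
have fM : {morph f : x y / x * y} by move=> x y; rewrite /f gw_red gw_cat.
pose fH := isMultiplicative.Build (free_group T) G f fM.
by exists (HB.pack_for {multiplicative free_group T -> G} f fH) => w /=; apply: gw_red.
Qed.

Definition fg_lift (g : T -> G) : {multiplicative free_group T -> G} :=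
  sval (fg_lift_subproof g).

Lemma fg_lift_fg g w :
  fg_lift g (fg w) = foldr (fun l a => (if l.2 then g l.1 else (g l.1)^-1) * a) 1 w.
Proof. exact: (svalP (fg_lift_subproof g)). Qed.

Lemma fg_lift_gen g t : fg_lift g (fgen t) = g t.
Proof. by rewrite fg_lift_fg /= mulg1. Qed.

Lemma fg_ind (P : free_group T -> Prop) : P 1 ->
  (forall x t, P x -> P (fgen t * x)) -> (forall x t, P x -> P ((fgen t)^-1 * x)) ->
  forall x, P x.
Proof.
move=> P1 Pg PV x; rewrite -(fg_fword x).
elim: (fword x) => [|[t b] w IH] //; rewrite -cat1s fgM.
by case: b; [apply: Pg|rewrite -[[:: _]]/(winv [:: (t, true)]) fgV; apply: PV].
Qed.

Definition fsupp x : seq T := map fst (fword x).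

Lemma fg_hom_eq_supp (f1 f2 : {multiplicative free_group T -> G}) x :
  {in fsupp x, forall t, f1 (fgen t) = f2 (fgen t)} -> f1 x = f2 x.
Proof.
rewrite /fsupp -{2 3}(fg_fword x).
elim: (fword x) => [|[t b] w IH] f12; first by rewrite fg1 !hom1g.
rewrite -cat1s fgM !gmulfM IH => [|s ws]; last by rewrite f12 // inE ws orbT.
congr (_ * _); case: b f12 => f12; first by rewrite f12 // mem_head.
by rewrite -[[:: _]]/(winv [:: (t, true)]) fgV !homVg f12 // mem_head.
Qed.

Lemma fg_hom_eq (f1 f2 : {multiplicative free_group T -> G}) :
  (forall t, f1 (fgen t) = f2 (fgen t)) -> f1 =1 f2.
Proof. by move=> f12 x; apply: fg_hom_eq_supp => t _. Qed.

End FreeGroup.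

(** * Semidirect products and the action on cosets *)

(** The laws of the action are parameters of the type, so that the group structure can be attached
    to it. *)
Record semidirect (N H : groupType) (act : H -> {multiplicative N -> N})
    (act1 : forall x, act 1 x = x)
    (actM : forall g h x, act (g * h) x = act g (act h x)) :=
  Semidirect { sdl : N; sdr : H }.

Section Semidirect.
Variables (N H : groupType) (act : H -> {multiplicative N -> N}).
Variables (act1 : forall x, act 1 x = x)
          (actM : forall g h x, act (g * h) x = act g (act h x)).

Local Notation sd := (semidirect act1 actM).
Local Notation Sd := (Semidirect act1 actM).

Let sd_pair (x : sd) := (sdl x, sdr x).
Let pair_sd (p : N * H) := Sd p.1 p.2.
Let sd_pairK : cancel sd_pair pair_sd. Proof. by case. Qed.

HB.instance Definition _ := Choice.copy sd (can_type sd_pairK).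

Definition sd_mul (x y : sd) := Sd (sdl x * act (sdr x) (sdl y)) (sdr x * sdr y).
Definition sd_inv (x : sd) := Sd (act (sdr x)^-1 (sdl x)^-1) (sdr x)^-1.

Fact sd_mulA : associative sd_mul.
Proof. by move=> x y z; rewrite /sd_mul /= gmulfM actM !mulgA. Qed.

Fact sd_mul1 : left_id (Sd 1 1) sd_mul.
Proof. by case=> n h; rewrite /sd_mul /= act1 !mul1g. Qed.

Fact sd_mulr1 : right_id (Sd 1 1) sd_mul.
Proof. by case=> n h; rewrite /sd_mul /= hom1g !mulg1. Qed.

Fact sd_mulV : left_inverse (Sd 1 1) sd_inv sd_mul.
Proof. by case=> n h; rewrite /sd_mul /= -gmulfM !mulVg hom1g. Qed.

Fact sd_mulrV : right_inverse (Sd 1 1) sd_inv sd_mul.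
Proof. by case=> n h; rewrite /sd_mul /= -actM !mulgV act1 mulgV. Qed.

HB.instance Definition _ := isGroup.Build sd sd_mulA sd_mul1 sd_mulr1 sd_mulV sd_mulrV.

Lemma sd_mulE n h n' h' : Sd n h * Sd n' h' = Sd (n * act h n') (h * h').
Proof. by []. Qed.

Definition sd_inl n := Sd n 1.

Fact sd_inl_is_multiplicative : {morph sd_inl : x y / x * y}.
Proof. by move=> x y; rewrite /sd_inl sd_mulE act1 mulg1. Qed.

HB.instance Definition _ := isMultiplicative.Build N sd sd_inl sd_inl_is_multiplicative.

Lemma sd_inl_inj : injective sd_inl.
Proof. by move=> x y []. Qed.

Lemma sd_lift (K : groupType) (f : {multiplicative N -> K}) (g : {multiplicative H -> K}) :
  (forall h n, f (act h n) = f n ^ (g h)^-1) ->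
  exists phi : {multiplicative sd -> K}, forall x, phi x = f (sdl x) * g (sdr x).
Proof.
move=> fg; pose phi (x : sd) := f (sdl x) * g (sdr x).
have phiM : {morph phi : x y / x * y}.
  move=> [n h] [n' h']; rewrite /phi /= !gmulfM fg conjgE invgK !mulgA.
  by rewrite mulgVK.
pose phiH := isMultiplicative.Build sd K phi phiM.
by exists (HB.pack_for {multiplicative sd -> K} phi phiH).
Qed.

End Semidirect.

Section RaagHom.
Variables (V : finType) (e : rel V).

Lemma raag_ind (P : raag e -> Prop) : P 1 ->
  (forall x v, P x -> P (raag_gen e v * x)) ->
  (forall x v, P x -> P ((raag_gen e v)^-1 * x)) ->
  forall x, P x.
Proof.
move=> P1 Pg PV x; rewrite -(raag_of_repr x).
elim: (repr x) => [|[v b] w IH] //; rewrite -cat1s raag_ofM.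
case: b; first exact: Pg.
by rewrite -[[:: _]]/(inv_word [:: (v, true)]) raag_ofV; apply: PV.
Qed.

Lemma raag_hom_eq (G : groupType) (f1 f2 : {multiplicative raag e -> G}) :
  (forall v, f1 (raag_gen e v) = f2 (raag_gen e v)) -> f1 =1 f2.
Proof.
move=> f12; elim/raag_ind => [|x v IH|x v IH]; first by rewrite !hom1g.
  by rewrite !gmulfM f12 IH.
by rewrite !gmulfM !homVg f12 IH.
Qed.

End RaagHom.

(** * Cosets of the link subgroups and their permutation by the free group *)

Section Cosets.
Variables (V : finType) (e : rel V).
Local Notation F := (free_group V).

(** Retraction onto the subgroup generated by the link of [a]; membership in that subgroup becomes
    the equation of being fixed by it. *)
Definition link_retract (a : V) : {multiplicative F -> F} :=
  fg_lift (fun b => if e a b then fgen b else 1).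
Local Notation rho := link_retract.

Lemma link_retractK a h : rho a (rho a h) = rho a h.
Proof.
apply: (@fg_hom_eq _ _ (rho a \o rho a) (rho a)) => b /=.
by rewrite !fg_lift_gen; case: ifP => ab; rewrite ?hom1g // fg_lift_gen ab.
Qed.

(* [k * (rho a k)^-1] is a canonical representative of the left coset of [k]
   modulo the subgroup generated by the link of [a], so [(a, k)] with
   [rho a k = 1] stands for that coset. *)
Definition link_coset := {x : V * F | rho x.1 x.2 == 1}.
Local Notation X := link_coset.
HB.instance Definition _ := Choice.on link_coset.
HB.instance Definition _ := SubType.on link_coset.

Fact coset_act_subproof (h : F) (x : X) :
  rho (val x).1 (h * (val x).2 * (rho (val x).1 h)^-1) == 1.
Proof.
by case: x => -[a k] /= /eqP ak; rewrite !gmulfM homVg link_retractK ak mulg1 mulgV.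
Qed.

Definition coset_act h (x : X) : X :=
  exist _ ((val x).1, h * (val x).2 * (rho (val x).1 h)^-1) (coset_act_subproof h x).

Fact link_coset1_subproof a : rho a 1 == 1. Proof. by rewrite hom1g. Qed.

Definition link_coset1 a : X := exist _ (a, 1) (link_coset1_subproof a).

Lemma coset_act1 x : coset_act 1 x = x.
Proof.
by apply: val_inj; case: x => -[a k] ak /=; rewrite hom1g mul1g invg1 mulg1.
Qed.

Lemma coset_actM g h x : coset_act (g * h) x = coset_act g (coset_act h x).
Proof.
by apply: val_inj; case: x => -[a k] ak /=; rewrite gmulfM invgM !mulgA.
Qed.

Lemma coset_act_inj h : injective (coset_act h).
Proof.
by apply: (can_inj (g := coset_act h^-1)) => x; rewrite -coset_actM mulVg coset_act1.
Qed.

(** The coset of [k] is fixed when [h ^ k] lies in the link subgroup, that is, equals its retract;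
    this is the retract of [h], because [k] retracts to 1. *)
Lemma coset_fixP h (x : X) :
  coset_act h x = x <-> h ^ (val x).2 = rho (val x).1 h.
Proof.
case: x => -[a k] ak; rewrite /= conjgE; split=> [/(congr1 val) [hk]|hk].
  by rewrite -[h * k](mulgVK (rho a h)) hk mulKg.
by apply: val_inj; rewrite /= -hk invgM invgK mulVKg.
Qed.

Lemma coset_fix_root h m x : coset_act (h ^+ m.+1) x = x -> coset_act h x = x.
Proof.
by move/coset_fixP; rewrite conjXg homXg => /fg_root_uniq hx; apply/coset_fixP.
Qed.

(** The quotient [c] of the two representatives commutes with [h] and retracts to 1. If [c] is
    nontrivial, it shares a power with [h], so [h] retracts to a torsion element, hence to 1; but
    that retract is conjugate to [h]. *)
Lemma coset_fix_uniq h x y : h != 1 -> coset_act h x = x -> coset_act h y = y ->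
  (val x).1 = (val y).1 -> x = y.
Proof.
move=> h1 /coset_fixP hx /coset_fixP hy.
case: x y hx hy => -[a k] ak [[a' k'] ak'] /= hk hk' aa'.
case: a' / aa' in ak' hk' *; apply: val_inj => /=; congr (_, _).
move/eqP: ak => /= ak; move/eqP: ak' => /= ak'.
pose c := k * k'^-1; apply: divg1_eq; rewrite -/c.
have cr : rho a c = 1 by rewrite /c gmulfM homVg ak ak' invg1 mulg1.
have hc : commute h c.
  by apply/commgP/conjg_fixP; rewrite /c conjgM hk -hk' conjgK.
apply/eqP/negPn/negP => c1; have [i [j hE]] := fg_commute_power h1 c1 hc.
suff r1 : rho a h = 1 by move/negP: h1; rewrite -(conjg_eq1 _ k) hk r1 eqxx.
apply: (@fg_torsion_free _ i); rewrite -homXg.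
by case: hE => ->; rewrite ?homXg ?homVg cr ?invg1 expg1n.
Qed.

Definition coset_act_hom h : {multiplicative free_group X -> free_group X} :=
  fg_lift (fun x => fgen (coset_act h x)).
Local Notation act := coset_act_hom.

Fact coset_act_hom1 f : act 1 f = f.
Proof.
apply: (@fg_hom_eq _ _ (act 1) idfun) => x /=.
by rewrite fg_lift_gen coset_act1.
Qed.

Fact coset_act_homM g h f : act (g * h) f = act g (act h f).
Proof.
apply: (@fg_hom_eq _ _ (act (g * h)) (act g \o act h)) => x /=.
by rewrite !fg_lift_gen coset_actM.
Qed.

(** The counterpart of [pA] on the free group on cosets; [raag_semidirect_proj] makes this
    precise. *)
Definition coset_label : {multiplicative free_group X -> F} :=
  fg_lift (fun x => fgen (val x).1).

Lemma coset_label_act h f : coset_label (act h f) = coset_label f.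
Proof.
apply: (@fg_hom_eq _ _ (coset_label \o act h) coset_label) => x /=.
by rewrite !fg_lift_gen.
Qed.

End Cosets.

Lemma eventually_all (T : eqType) (P : T -> nat -> Prop) (s : seq T) :
  (forall x, exists M, forall m, M <= m -> P x m) ->
  exists M, forall m, M <= m -> {in s, forall x, P x m}.
Proof.
move=> PM; elim: s => [|x s [M IH]]; first by exists 0.
have [N PN] := PM x; exists (maxn M N) => m; rewrite geq_max => /andP[Mm Nm] y.
by rewrite inE => /predU1P[-> //|]; [apply: PN|apply: IH].
Qed.

(** * Infinite orbits of cosets and centralizers *)

Section CosetDynamics.
Variables (V : finType) (e : rel V).
Local Notation F := (free_group V).
Local Notation X := (link_coset e).
Local Notation act := (@coset_act_hom V e).
Implicit Types (h : F) (x y : X) (f t : free_group X).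

(* By [coset_fix_root] a point not fixed by [h] has an infinite orbit. *)
Lemma coset_act_wandering h (s : seq X) : exists m, {in s &, forall x y,
  coset_act (h ^+ m) x = y -> coset_act h x = x}.
Proof.
pose P (p : X * X) m := coset_act (h ^+ m) p.1 = p.2 -> coset_act h p.1 = p.1.
have [|M PM] := @eventually_all _ P [seq (x, y) | x <- s, y <- s]; last first.
  by exists M => x y xs ys; apply: (PM M (leqnn M) (x, y)); apply/allpairsP; exists (x, y).
move=> [x y]; have [[m hm]|no] := pselect (exists m, coset_act (h ^+ m) x = y).
  (* If [h ^+ m] and a later [h ^+ n] both send [x] to [y], then a positive power of [h] fixes [x],
     hence so does [h]. *)
  exists m.+1 => n mn; rewrite /P /= -hm -(subnKC mn) addSnnS expgnDr coset_actM.
  by move/coset_act_inj/coset_fix_root.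
by exists 0 => m _ hm; case: no; exists m.
Qed.

Definition fixed_retract h : {multiplicative free_group X -> free_group X} :=
  fg_lift (fun x => if coset_act h x == x then fgen x else 1).

(* Iterating the hypothesis, [t] is conjugate to [act (h ^+ m) t] for all [m].
   For suitable [m], killing the letters that are neither fixed nor in [t]
   preserves [t] and turns [act (h ^+ m) t] into [fixed_retract h t]. *)
Lemma fixed_retract_conj h f t : t * f = f * act h t ->
  exists c, fixed_retract h t = t ^ c.
Proof.
move=> tf.
have tJ m : exists c, act (h ^+ m) t = t ^ c.
  elim: m => [|m [c IH]]; first by exists 1; rewrite coset_act_hom1 conjg1.
  have ht : act h t = t ^ f by rewrite conjgE tf mulKg.
  by rewrite expgSr coset_act_homM ht homJg IH -conjgM; eexists.
have [m wander] := coset_act_wandering h (fsupp t); have [c tc] := tJ m.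
pose kill : {multiplicative free_group X -> free_group X} :=
  fg_lift (fun x => if (coset_act h x == x) || (x \in fsupp t) then fgen x else 1).
have kill_t : kill t = t.
  apply: (@fg_hom_eq_supp _ _ kill idfun) => x xt /=.
  by rewrite fg_lift_gen xt orbT.
exists (kill c); rewrite -{2}kill_t -homJg -tc; apply/esym.
apply: (@fg_hom_eq_supp _ _ (kill \o act (h ^+ m)) (fixed_retract h)) => x xt /=.
rewrite !fg_lift_gen; case: (coset_act h x =P x) => [hx|hx].
  have -> : coset_act (h ^+ m) x = x.
    elim: (m) => [|k IH]; first exact: coset_act1.
    by rewrite expgS coset_actM IH.
  by rewrite hx eqxx.
(* If [kill] kept the image of [x] under [h ^+ m], this image would be fixed by [h] or lie in
   [fsupp t]. Either makes [h] fix [x], by injectivity or by [wander]. *)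
case: ifP => // /orP[/eqP|] hmx; case: hx; last exact: (wander _ _ xt hmx).
apply: (coset_act_inj (h := h ^+ m)).
by rewrite -coset_actM -expgSr expgS coset_actM.
Qed.

(** By [coset_fix_uniq] each label has at most one fixed letter, so sending a label to that letter,
    or to 1 if there is none, inverts [coset_label] on words in fixed letters. *)
Lemma coset_label_fixed_inj h t : h != 1 ->
  coset_label e (fixed_retract h t) = 1 -> fixed_retract h t = 1.
Proof.
move=> h1.
pose fixed a x := coset_act h x = x /\ (val x).1 = a.
pose section : {multiplicative F -> free_group X} := fg_lift (fun a =>
  if pselect (exists x, fixed a x) is left ex then fgen (projT1 (cid ex)) else 1).
suff tE : section (coset_label e (fixed_retract h t)) = fixed_retract h t.
  by move=> t1; rewrite -tE t1 hom1g.
apply: (@fg_hom_eq _ _ (section \o (coset_label e \o fixed_retract h))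
  (fixed_retract h)) => x /=.
rewrite [fixed_retract _ _]fg_lift_gen; case: eqP => [hx|_]; last by rewrite !hom1g.
rewrite !fg_lift_gen; case: pselect => [ex|[]]; last by exists x.
by case: cid => y [hy yx] /=; rewrite (coset_fix_uniq h1 hy hx yx).
Qed.

(** The equation [t * f = f * act h t] says that [(t, 1)] and [(f, h)] commute in the semidirect
    product. *)
Lemma coset_label_inj_centralizer h f t : h != 1 -> t * f = f * act h t ->
  coset_label e t = 1 -> t = 1.
Proof.
move=> h1 /fixed_retract_conj[c tc] t1; apply/eqP; rewrite -(conjg_eq1 t c) -tc.
by apply/eqP/coset_label_fixed_inj => //; rewrite tc homJg t1 conj1g.
Qed.

End CosetDynamics.

(** * Bipartite groups inside a semidirect product of free groups *)

Section Bipartite.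
Variables (V : finType) (e : rel V) (A : pred V).
Hypotheses (e_sym : symmetric e) (eA : forall u v, e u v -> A u != A v).
Local Notation F := (free_group V).
Local Notation X := (link_coset e).
Local Notation act := (@coset_act_hom V e).
Local Notation SD := (semidirect (@coset_act_hom1 V e) (@coset_act_homM V e)).
Local Notation Sd := (Semidirect (@coset_act_hom1 V e) (@coset_act_homM V e)).

Lemma raag_semidirect : exists2 phi : {multiplicative raag e -> SD}, injective phi &
  forall v, phi (raag_gen e v) =
    if A v then Sd (fgen (link_coset1 e v)) 1 else Sd 1 (fgen v).
Proof.
pose g v := if A v then Sd (fgen (link_coset1 e v)) 1 else Sd 1 (fgen v).
have gC a b : e a b -> A a -> ~~ A b -> commute (g a) (g b).
  move=> ab Aa Ab; rewrite /g Aa (negbTE Ab) /commute !sd_mulE.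
  rewrite coset_act_hom1 !mulg1 !mul1g; congr Sd; rewrite fg_lift_gen.
  congr fgen; apply: val_inj; rewrite /= fg_lift_gen ab mulg1 mulgV //.
have [phi phiE] : exists phi : {multiplicative raag e -> SD},
    forall v, phi (raag_gen e v) = g v.
  apply: raag_lift => u v uv; have := eA uv.
  case Au: (A u); case Av: (A v) => // _; first by apply: gC; rewrite ?Av.
  by apply/commute_sym/gC; rewrite ?Au // e_sym.
exists phi => //.
pose psi2 : {multiplicative F -> raag e} :=
  fg_lift (fun b => if A b then 1 else raag_gen e b).
pose psi1 : {multiplicative free_group X -> raag e} :=
  fg_lift (fun x => raag_gen e (val x).1 ^ (psi2 (val x).2)^-1).
have psi2C a h : commute (raag_gen e a) (psi2 (link_retract e a h)).
  elim/fg_ind: h => [|h b IH|h b IH]; first by rewrite !hom1g; apply: commute1.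
    rewrite !gmulfM; apply: commuteM => //; rewrite fg_lift_gen.
    case: ifP => ab; last by rewrite hom1g; apply: commute1.
    by rewrite fg_lift_gen; case: ifP => _; [apply: commute1|apply: raag_gen_commute].
  rewrite !gmulfM !homVg; apply: commuteM => //; apply: commuteV; rewrite fg_lift_gen.
  case: ifP => ab; last by rewrite hom1g; apply: commute1.
  by rewrite fg_lift_gen; case: ifP => _; [apply: commute1|apply: raag_gen_commute].
have psi1J h f : psi1 (act h f) = psi1 f ^ (psi2 h)^-1.
  have psi1g x : psi1 (fgen (coset_act h x)) = psi1 (fgen x) ^ (psi2 h)^-1.
    rewrite !fg_lift_gen /= !gmulfM homVg !invgM invgK !conjgM.
    by have /commgP/conjg_fixP -> := psi2C (val x).1 h.
  elim/fg_ind: f => [|f x IH|f x IH]; first by rewrite !hom1g conj1g.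
    by rewrite !gmulfM IH fg_lift_gen psi1g conjMg.
  by rewrite !gmulfM !homVg IH fg_lift_gen psi1g conjMg conjVg.
have [psi psiE] := sd_lift (@coset_act_hom1 V e) (@coset_act_homM V e) psi1J.
apply: (can_inj (g := psi)) => x.
apply: (@raag_hom_eq _ _ _ (psi \o phi) idfun) => v /=.
rewrite phiE psiE /g; case Av: (A v); rewrite /= !hom1g !fg_lift_gen /=.
  by rewrite hom1g invg1 conjg1 mulg1.
by rewrite mul1g Av.
Qed.

End Bipartite.

(** * Kernels of the two projections *)

Section BipartiteProjections.
Variables (V : finType) (e : rel V) (A : pred V).
Hypotheses (e_sym : symmetric e) (eA : forall u v, e u v -> A u != A v).
Local Notation F := (free_group V).
Local Notation SD := (semidirect (@coset_act_hom1 V e) (@coset_act_homM V e)).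
Local Notation Sd := (Semidirect (@coset_act_hom1 V e) (@coset_act_homM V e)).

Lemma raag_part_proj (B : pred V) : (forall u v, e u v -> ~~ (B u && B v)) ->
  exists p : {multiplicative raag e -> F},
    forall v, p (raag_gen e v) = if B v then fgen v else 1.
Proof.
move=> eB; apply: (@raag_lift _ _ _ (fun v => if B v then fgen v else 1)) => u v /eB.
case: (B u) => /= [/negbTE ->|_]; first exact: commute1.
exact/commute_sym/commute1.
Qed.

Variable pB : {multiplicative raag e -> F}.
Hypothesis pBE : forall v, pB (raag_gen e v) = if A v then 1 else fgen v.

Lemma raag_semidirect_proj : exists2 phi : {multiplicative raag e -> SD},
  injective phi & (forall x, sdr (phi x) = pB x) /\
  (forall pA : {multiplicative raag e -> F},
     (forall v, pA (raag_gen e v) = if A v then fgen v else 1) ->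
     forall x, coset_label e (sdl (phi x)) = pA x).
Proof.
have [phi phi_inj phiE] := raag_semidirect e_sym eA; exists phi => //.
(* [pr] and [pl] are the second component and the label of the first one, as homomorphisms; each can
   then be compared with a projection on generators. *)
have [|pr prE] := @sd_lift _ _ _ (@coset_act_hom1 V e) (@coset_act_homM V e) F
  (@one_fun _ F) idfun; first by move=> h f /=; rewrite conj1g.
have [|pl plE] := @sd_lift _ _ _ (@coset_act_hom1 V e) (@coset_act_homM V e) F
  (coset_label e) (@one_fun _ F).
  by move=> h f /=; rewrite coset_label_act invg1 conjg1.
split=> [|pA pAE] x.
  rewrite -[LHS]mul1g -[LHS](prE (phi x)).
  apply: (@raag_hom_eq _ _ _ (pr \o phi) pB) => v /=.
  by rewrite prE phiE pBE /= mul1g; case: (A v).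
rewrite -[LHS]mulg1 -[LHS](plE (phi x)).
apply: (@raag_hom_eq _ _ _ (pl \o phi) pA) => v /=.
by rewrite plE phiE pAE /= mulg1; case: (A v); rewrite /= ?hom1g // fg_lift_gen.
Qed.

Lemma ker_sd_inl (phi : {multiplicative raag e -> SD}) :
  (forall x, sdr (phi x) = pB x) -> forall x, pB x = 1 ->
  exists x', phi x = sd_inl (@coset_act_hom1 V e) (@coset_act_homM V e) x'.
Proof.
move=> phiB x; rewrite -phiB; case: (phi x) => f h /= ->.
by exists f.
Qed.

(** The embedding carries the kernel of [pB] into the free normal factor, where [fg_commute_power]
    applies. *)
Lemma ker_commute_power x y : pB x = 1 -> pB y = 1 -> x != 1 -> y != 1 ->
  commute x y -> exists i j, x ^+ i.+1 = y ^+ j.+1 \/ x ^+ i.+1 = y^-1 ^+ j.+1.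
Proof.
have [phi phi_inj [phiB _]] := raag_semidirect_proj.
move=> /(ker_sd_inl phiB)[x' xE] /(ker_sd_inl phiB)[y' yE] x1 y1 xy.
have neq1 z z' : phi z = sd_inl _ _ z' -> z != 1 -> z' != 1.
  move=> zE; apply: contraNneq => z'1; apply/eqP/phi_inj.
  by rewrite zE z'1 !hom1g.
have xy' : commute x' y'.
  apply: (@sd_inl_inj _ _ _ (@coset_act_hom1 V e) (@coset_act_homM V e)).
  by rewrite !gmulfM /= -xE -yE -!gmulfM xy.
have [i [j ij]] := fg_commute_power (neq1 _ _ xE x1) (neq1 _ _ yE y1) xy'.
exists i, j; case: ij => ij; [left|right]; apply: phi_inj;
  by rewrite !homXg ?homVg xE yE -?homVg -!homXg ij.
Qed.

Lemma ker_commute_relation x y : pB x = 1 -> pB y = 1 -> x != 1 -> commute x y ->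
  exists i j k, y ^+ i.+1 * x ^+ j = x ^+ k.
Proof.
move=> kx ky x1 xy; have [->|y1] := eqVneq y 1.
  by exists 0, 0, 0; rewrite expg1n mulg1.
have [j [i [yE|yE]]] := ker_commute_power ky kx y1 x1 (commute_sym xy).
  by exists j, 0, i.+1; rewrite yE mulg1.
by exists j, i.+1, 0; rewrite yE expVgn mulVg.
Qed.

Lemma ker_inter_centralizer (pA : {multiplicative raag e -> F}) t g :
  (forall v, pA (raag_gen e v) = if A v then fgen v else 1) ->
  pA t = 1 -> pB t = 1 -> commute t g -> pB g != 1 -> t = 1.
Proof.
have [phi phi_inj [phiB phiA]] := raag_semidirect_proj.
move=> /phiA{}phiA; rewrite -phiA -!phiB => t1 t2 tg g1; apply: phi_inj.
have := congr1 (@sdl _ _ _ _ _) (congr1 phi tg).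
rewrite !gmulfM hom1g; case: (phi t) (phi g) t1 t2 g1 => n h [f k] /= n1 -> k1.
rewrite coset_act_hom1 => nf; congr Semidirect.
exact: (coset_label_inj_centralizer k1 nf n1).
Qed.

End BipartiteProjections.

(** * Closed paths and the embedding *)

Section ClosedPaths.
Variables (V : finType) (e : rel V).

Lemma closed_path_cycle x p : path e x p -> last x p = x -> cycle e p.
Proof. by case: p => //= y p /andP[xy py] px; rewrite rcons_path py px. Qed.

Lemma path_alternate (A : pred V) x p :
  path (fun u v => A u != A v) x p -> A (last x p) = A x (+) odd (size p).
Proof.
elim: p x => [|y p IH] x /=; first by rewrite addbF.
by case/andP => xy /IH ->; case: (A x) (A y) xy => -[] //= _; case: odd.
Qed.

Lemma cycle_alternate (A : pred V) c :
  cycle (fun u v => A u != A v) c -> ~~ odd (size c).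
Proof.
case: c => //= x c /path_alternate; rewrite last_rcons size_rcons /=.
by case: (A x); case: odd.
Qed.

(** Reduces a property of all cyclically consecutive pairs to the first two entries of each
    rotation, the form in which absence of backtracking is stated. *)
Lemma cycle_of_rot (r : rel V) c : 1 < size c ->
  (forall i x y s, rot i c = x :: y :: s -> r x y) -> cycle r c.
Proof.
case: c => [|h c] //= c0 rr.
suff rq q p y : h :: c = p ++ y :: q -> path r y (rcons q h) by apply: (rq c [::] h).
elim: q p y => [|z q IH] p y /= cE.
  case: p cE => [[_ c1]|x p [hx cE]]; first by rewrite c1 in c0.
  subst x; rewrite andbT; apply: (rr (size (h :: p)) _ _ p).
  by rewrite cE -cat_cons rot_size_cat.
rewrite (IH (rcons p y)) ?cat_rcons // andbT.
by apply: (rr (size p) _ _ (q ++ p)); rewrite cE rot_size_cat.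
Qed.

(** Colour a vertex by whether an odd walk reaches it from the root of its component. Walks of both
    parities to one vertex would close up to an odd closed path. *)
Lemma bipartition : symmetric e -> ~ has_odd_closed_path e ->
  exists A : pred V, forall u v, e u v -> A u != A v.
Proof.
move=> e_sym noodd; have e_csym := sym_connect_sym e_sym.
pose A v := `[< exists p, [/\ path e (root e v) p, last (root e v) p = v & odd (size p)] >].
have even_odd x v p q : path e x p -> last x p = v -> odd (size p) ->
    path e x q -> last x q = v -> odd (size q).
  move=> xp pv op xq qv; apply: contrapT => /negP oq; apply: noodd.
  exists (p ++ rev (belast x q)).
    apply: (@closed_path_cycle x).
      rewrite cat_path xp pv -qv rev_path /=.
      by rewrite (eq_path (e' := e)) // => y z; rewrite e_sym.
    rewrite last_cat pv; case: q qv {xq oq} => [<- //|y q _] /=.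
    by rewrite rev_cons last_rcons.
  by rewrite size_cat oddD op size_rev size_belast (negbTE oq).
exists A => u v uv.
have ruv : root e u = root e v by apply/(rootP e_csym)/connect1.
apply/eqP => Auv; have [Au|Au] := boolP (A u).
  have /asboolP[p [xp pu op]] := Au; move: Au; rewrite Auv => /asboolP[q [xq qv oq]].
  have := @even_odd (root e v) v q (rcons p v) xq qv oq.
  by rewrite last_rcons size_rcons /= op rcons_path -ruv xp pu uv /= => /(_ isT erefl).
have /connectP[p xp pu] : connect e (root e u) u by rewrite e_csym connect_root.
move: (Au); rewrite Auv => /negP; apply; apply/asboolP.
exists (rcons p v); rewrite last_rcons size_rcons rcons_path -ruv xp -pu uv.
by split=> //=; apply: contra Au => op; apply/asboolP; exists p.
Qed.

(* Backtracking steps can be removed without changing parity. *)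
Lemma odd_cycle_no_backtrack c : irreflexive e ->
  cycle e c -> odd (size c) -> exists c', [/\ cycle e c', odd (size c'), 2 < size c' &
  forall i x y z t s, rot i c' = [:: x, y, z, t & s] -> x != z /\ y != t].
Proof.
move=> e_irr; have [n] := ubnP (size c); elim: n c => // n IH c cn cc oc.
have [[i [x [y [z [t [s [cE xyzt]]]]]]]|no] := pselect (exists i x y z t s,
    rot i c = [:: x, y, z, t & s] /\ (x = z \/ y = t)).
  have sc : size c = (size s).+4 by rewrite -(size_rot i c) cE.
  have [c' [cc' sc']] : exists c', cycle e c' /\ size c' = (size s).+2.
    move: cc; rewrite -(rot_cycle i) cE /= => /and4P[xy yz zt ts].
    (* If [x = z], drop the first two vertices; if [y = t], drop the third and fourth. *)
    case: xyzt => [xz|yt]; [exists [:: z, t & s]|exists [:: x, y & s]].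
      by rewrite /= zt -xz ts.
    by rewrite /= xy yt ts.
  apply: (IH c') => //; last by move: oc; rewrite sc sc' /= !negbK.
  by move: cn; rewrite sc sc' ltnS => /ltnW.
exists c; split=> // [|i x y z t s cE].
  (* An odd length below 3 is 1, which would be a loop. *)
  case: c oc cc {cn no} => [|x [|y [|z c]]] //= _.
  by rewrite e_irr.
by split; apply/eqP => xyzt; apply: no; exists i, x, y, z, t, s; split=> //; [left|right].
Qed.

End ClosedPaths.

(** Killing all generators but [u] and [v] maps to a free group, where distinct generators do not
    commute. *)
Lemma raag_gen_noncommute (V : finType) (e : rel V) u v : simplicial e ->
  u != v -> ~~ e u v -> ~ commute (raag_gen e u) (raag_gen e v).
Proof.
move=> [e_sym e_irr] uv neuv.
pose g w : free_group V := if (w == u) || (w == v) then fgen w else 1.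
have [a b ab|f fE] := @raag_lift V e _ g.
  rewrite /g; case: ifP => [|_]; last exact/commute_sym/commute1.
  case: ifP => [|_ _]; last exact: commute1.
  move=> /orP[] /eqP bE /orP[] /eqP aE; move: ab; rewrite aE bE ?e_irr //.
    by rewrite e_sym (negbTE neuv).
  by rewrite (negbTE neuv).
move=> /(gmulf_commute f); rewrite !fE /g !eqxx orbT /= => /(congr1 (@fword V)).
rewrite -[LHS]/(red [:: (u, true); (v, true)]) -[RHS]/(red [:: (v, true); (u, true)]).
rewrite !red_id ?/(reduced _) /= /ncancel ?xpair_eqE ?andbF // => -[/eqP].
by rewrite (negbTE uv).
Qed.

Lemma fgen_neq1 (T : choiceType) (t : T) : fgen t != 1.
Proof. by rewrite -fword_eq1. Qed.

(** * Constraints on the images of generators under an embedding *)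

Section Embedding.
Variables (V1 V2 : finType) (e1 : rel V1) (e2 : rel V2).
Hypotheses (e1_irr : irreflexive e1) (e2_sym : symmetric e2).
Variable phi : {multiplicative raag e1 -> raag e2}.
Hypothesis phi_inj : injective phi.
Local Notation gen := (raag_gen e1).

Section Side.
Variable A : pred V2.
Hypothesis eA : forall u v, e2 u v -> A u != A v.
Variable pB : {multiplicative raag e2 -> free_group V2}.
Hypothesis pBE : forall v, pB (raag_gen e2 v) = if A v then 1 else fgen v.

(** These projections detect the exponent of a single generator and so refute relations between
    powers of commuting elements. *)
Lemma single_proj v : exists q : {multiplicative raag e1 -> free_group V1},
  forall w, q (gen w) = if w == v then fgen w else 1.
Proof.
apply: (@raag_part_proj _ e1 (pred1 v)) => u w /=.
by apply: contraTN => /andP[/eqP-> /eqP->]; rewrite e1_irr.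
Qed.

Lemma embed_ker_relation x y : x != 1 -> commute x y ->
  pB (phi x) = 1 -> pB (phi y) = 1 -> exists i j k, y ^+ i.+1 * x ^+ j = x ^+ k.
Proof.
move=> x1 xy kx ky.
have px1 : phi x != 1 by apply: contra x1 => /eqP px; apply/eqP/phi_inj; rewrite hom1g.
have [i [j [k r]]] := ker_commute_relation e2_sym eA pBE kx ky px1 (gmulf_commute phi xy).
by exists i, j, k; apply: phi_inj; rewrite gmulfM !homXg.
Qed.

Lemma gen_neq1 v : gen v != 1.
Proof.
have [q qE] := single_proj v; apply/eqP => /(congr1 q).
by rewrite qE eqxx hom1g => /eqP; apply/negP/fgen_neq1.
Qed.

(** If both were in the kernel, its freeness would make a positive power of [gen v] a power of
    [gen u], possibly negative; projecting to [v] gives torsion. *)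
Lemma edge_ker u v : e1 u v -> pB (phi (gen u)) = 1 -> pB (phi (gen v)) != 1.
Proof.
move=> uv ku; apply/eqP => kv.
have [i [j [k]]] := embed_ker_relation (gen_neq1 u) (raag_gen_commute uv) ku kv.
have [q qE] := single_proj v; have uNv : u == v = false.
  by apply/eqP => uvE; rewrite uvE e1_irr in uv.
move/(congr1 q); rewrite gmulfM !homXg !qE uNv eqxx !expg1n mulg1.
by move/fg_torsion_free/eqP; apply/negP/fgen_neq1.
Qed.

(** Otherwise the images of [v] and [w] under [pB] have powers in the cyclic group generated by that
    of [u]. Correcting by powers of [u] puts two independent commuting elements in the kernel, which
    is free. *)
Lemma triangle_ker u v w : e1 u v -> e1 u w -> e1 v w -> pB (phi (gen u)) = 1.
Proof.
move=> uv uw vw; apply/eqP/negPn/negP => ku.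
have pC a b : e1 a b -> commute (pB (phi (gen a))) (pB (phi (gen b))).
  by move=> ab; do 2!apply: gmulf_commute; apply: raag_gen_commute.
have [i [j [k rv]]] := fg_commute_relation ku (pC _ _ uv).
have [i' [j' [k' rw]]] := fg_commute_relation ku (pC _ _ uw).
pose r := gen v ^+ i.+1 * gen u ^+ j * (gen u ^+ k)^-1.
pose s := gen w ^+ i'.+1 * gen u ^+ j' * (gen u ^+ k')^-1.
have kr : pB (phi r) = 1 by rewrite !gmulfM !homVg !homXg rv mulgV.
have ks : pB (phi s) = 1 by rewrite !gmulfM !homVg !homXg rw mulgV.
have neq a b : e1 a b -> a == b = false.
  by move=> ab; apply/eqP => abE; rewrite abE e1_irr in ab.
have [qw qwE] := single_proj w; have [qv qvE] := single_proj v.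
have qws : qw s = fgen w ^+ i'.+1.
  by rewrite !gmulfM !homVg !homXg !qwE eqxx (neq _ _ uw) !expg1n invg1 !mulg1.
have qvs : qv s = 1.
  rewrite !gmulfM !homVg !homXg !qvE [w == v]eq_sym (neq _ _ uv) (neq _ _ vw).
  by rewrite !expg1n invg1 !mulg1.
have qvr : qv r = fgen v ^+ i.+1.
  by rewrite !gmulfM !homVg !homXg !qvE eqxx (neq _ _ uv) !expg1n invg1 !mulg1.
have s1 : s != 1.
  apply/eqP => s1; move: qws; rewrite s1 hom1g => /esym/fg_torsion_free/eqP.
  exact/negP/fgen_neq1.
have sr : commute s r.
  have uC := raag_gen_commute uv; have uwC := raag_gen_commute uw.
  have vwC := raag_gen_commute vw.
  apply: commuteM; [apply: commuteM|apply: commuteV];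
    apply: commute_sym; (apply: commuteM; [apply: commuteM|apply: commuteV]);
    by apply: commuteX2 => //; apply: commute_sym.
have [m [a [b]]] := embed_ker_relation s1 sr ks kr.
move/(congr1 qv); rewrite gmulfM !homXg qvs qvr !expg1n mulg1.
by do 2!move/fg_torsion_free; move/eqP; apply/negP/fgen_neq1.
Qed.

Lemma wedge_ker (pA : {multiplicative raag e2 -> free_group V2}) u v w :
  (forall v, pA (raag_gen e2 v) = if A v then fgen v else 1) ->
  symmetric e1 -> e1 u v -> e1 v w -> u != w -> ~~ e1 u w ->
  pA (phi (gen v)) = 1 \/ pB (phi (gen v)) = 1.
Proof.
move=> pAE e1_sym uv vw uNw nuw.
have [kA|kA] := eqVneq (pA (phi (gen v))) 1; [by left|right].
apply/eqP/negPn/negP => kB.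
pose t := [~ gen u, gen w].
have uvC := raag_gen_commute uv; have vwC := raag_gen_commute vw.
have ker (p : {multiplicative raag e2 -> free_group V2}) :
    p (phi (gen v)) != 1 -> p (phi t) = 1.
  move=> pv; rewrite !homRg; apply/eqP/commgP; apply: (fg_commute_trans pv);
    by do 2!apply: gmulf_commute.
have tv : commute t (gen v).
  apply: commute_sym; have uvC' := commute_sym uvC.
  by do ?[apply: commuteM | apply: commuteV].
have := ker_inter_centralizer e2_sym eA pBE pAE (ker _ kA) (ker _ kB)
  (gmulf_commute phi tv) kB.
rewrite -(hom1g phi) => /phi_inj/eqP/commgP.
exact: raag_gen_noncommute.
Qed.

End Side.

End Embedding.

Theorem corollary5p7 (V1 V2 : finType) (e1 : rel V1) (e2 : rel V2)
  (simple1 : simplicial e1) (simple2 : simplicial e2)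
  (odd1 : has_odd_closed_path e1) (noodd2 : ~ has_odd_closed_path e2) :
  ~ isomorphic_to_subgroup (raag e1) (raag e2).
Proof.
case: simple1 simple2 odd1 => [e1_sym e1_irr] [e2_sym _] [c0 cyc0 odd0] [S _ [phi phi_inj _]].
have [A eA] := bipartition e2_sym noodd2.
(* The complement of [A] is a bipartition as well, so facts about [pB] also hold for [pA]. *)
have eA' u v : e2 u v -> ~~ A u != ~~ A v by rewrite (inj_eq negb_inj); apply: eA.
have [pB pBE'] : exists p : {multiplicative raag e2 -> free_group V2},
    forall v, p (raag_gen e2 v) = if ~~ A v then fgen v else 1.
  by apply: (@raag_part_proj _ _ (predC A)) => u v /eA /=; case: (A u) (A v) => -[].
have [pA pAE] : exists p : {multiplicative raag e2 -> free_group V2},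
    forall v, p (raag_gen e2 v) = if A v then fgen v else 1.
  by apply: (@raag_part_proj _ _ A) => u v /eA /=; case: (A u) (A v) => -[].
have pBE v : pB (raag_gen e2 v) = if A v then 1 else fgen v.
  by rewrite pBE'; case: (A v).
have pAE' v : pA (raag_gen e2 v) = if ~~ A v then 1 else fgen v.
  by rewrite pAE; case: (A v).
pose x v := phi (raag_gen e1 v).
have edgeB u v : e1 u v -> pB (x u) = 1 -> pB (x v) != 1.
  exact: (edge_ker e1_irr e2_sym phi_inj eA pBE).
have edgeA u v : e1 u v -> pA (x u) = 1 -> pA (x v) != 1.
  exact: (edge_ker e1_irr e2_sym phi_inj eA' pAE').
have triangle_free u v w : e1 u v -> e1 v w -> ~~ e1 u w.
  move=> uv vw; apply/negP => uw.
  have vu : e1 v u by rewrite e1_sym.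
  (* A triangle would put the images of both [u] and [v] in the kernel of [pB], against [edgeB]. *)
  have /eqP := triangle_ker e1_irr e2_sym phi_inj eA pBE vu vw uw.
  apply/negP; apply: (edgeB _ _ uv).
  exact: (triangle_ker e1_irr e2_sym phi_inj eA pBE uv uw vw).
have wedge u v w : e1 u v -> e1 v w -> u != w -> pA (x v) = 1 \/ pB (x v) = 1.
  move=> uv vw uw; have nuw := triangle_free _ _ _ uv vw.
  exact: (wedge_ker e1_irr e2_sym phi_inj eA pBE pAE e1_sym uv vw uw nuw).
have [c [cyc oddc c3 nobt]] := odd_cycle_no_backtrack e1_irr cyc0 odd0.
pose col v := pB (x v) == 1.
(* The colours are compared across the middle edge of four consecutive vertices; the shift by 1
   makes it the first edge of a rotation. *)
have : ~~ odd (size (rot 1 c)).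
  apply: (@cycle_alternate _ col); apply: cycle_of_rot; first by rewrite size_rot ltnW.
  move=> i b d s; rewrite rot_rot; move: (nobt i); rewrite -(rot_cycle i) in cyc.
  rewrite -(size_rot i) in c3 oddc.
  (* Length 3 leaves no four-vertex window and is excluded as a triangle. *)
  case: (rot i c) cyc c3 oddc => [|a [|b' [|d' [|f s']]]] //=.
    rewrite andbT => /and3P[ab bd da] _ _ _.
    by move/negP: (triangle_free _ _ _ ab bd); rewrite e1_sym.
  rewrite /rot /= => /and4P[ab bd df _] _ _ /(_ _ _ _ _ _ erefl)[ad bf] [<- <- _].
  have := wedge _ _ _ ab bd ad; have := wedge _ _ _ bd df bf.
  (* If [pB] is nontrivial at [b'], then [pA] is trivial there, hence nontrivial at [d'], and the
     wedge at [d'] makes [pB] trivial at [d']. *)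
  rewrite /col; have [kb|kb] := eqVneq (pB (x b')) 1.
    by rewrite (negbTE (edgeB _ _ bd kb)).
  move=> dAB [bA|/eqP]; last by rewrite (negbTE kb).
  by case: dAB => [dA|/eqP -> //]; move: (edgeA _ _ bd bA); rewrite dA eqxx.
by rewrite size_rot oddc.
Qed.
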